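(* Let $f_1,\dots,f_m:\mathbb{R}^n\to\mathbb{R}$ be convex and continuously differentiable, each $\nabla f_i$ being $L_i$-Lipschitz continuous with $L_i\ge 0$. Let $g:\mathbb{R}^m\to\mathbb{R}\cup\{+\infty\}$ be convex, proper, lower semicontinuous, $L_g$-Lipschitz continuous on its domain (i.e. $|g(u)-g(v)|\le L_g\|u-v\|$ for all $u,v\in\mathrm{dom}\,g$), and nondecreasing in its $i$-th argument for every $i$ with $L_i>0$. Put $F=(f_1,\dots,f_m)$, $$\Gamma=\{\bm{\alpha}\in\mathbb{R}^m_+:\ \alpha_i=0\text{ if }L_i=0,\ \alpha_i>0\text{ if }L_i>0,\ i=1,\dots,m\},$$ and, for $\bm{\alpha}\in\Gamma$, $H_{\bm{\alpha}}(x,y)=F(x)+\nabla F(x)(y-x)+\frac{\bm{\alpha}}{2}\|y-x\|^2$. Assume that $g\circ F$ is proper and has a minimizer, that $F^{-1}(\mathrm{int}\,\mathrm{dom}\,g)\neq\emptyset$, and that for every $x\in F^{-1}(\mathrm{dom}\,g)$ and every $\bm{\alpha}\in\Gamma$ the function $y\mapsto g(H_{\bm{\alpha}}(x,y))$ has a minimizer. Let $S=\mathrm{argmin}\,g\circ F$. Let $x_0\in F^{-1}(\mathrm{dom}\,g)$, $\bm{\alpha}_0\in\Gamma$, $\eta>1$, and let $(x_k)_{k\in\mathbb{N}}$, $(\bm{\alpha}_k)_{k\in\mathbb{N}}$ be any sequences generated from these data by the multiproximal method with backtracking step sizes (described in the context). Let $\hat{\bm{\alpha}}\in\Gamma$ be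 the vector with entries $\hat\alpha_i=\max\{\eta L_i,(\bm{\alpha}_0)_i\}$, $i=1,\dots,m$. Then, for every $x_*\in S$ and every sequence $(\nu_j)_{j\ge1}$ with $\nu_j\in\mathcal{V}_{\bm{\alpha}_j}(x_{j-1},x_j)$ for all $j\ge1$, $$g(F(x_k))-g(F(x_* ))\le\frac{\max_{j=1,\dots,k}\{\hat{\bm{\alpha}}^T\nu_j\}}{2k}\,\|x_0-x_*\|^2,\qquad\forall k\ge1.$$ Furthermore, the sequence $(x_k)_{k\in\mathbb{N}}$ converges to a point in $S$.
   Context: $\|\cdot\|$ is the Euclidean norm; $\mathrm{dom}\,g=\{z:g(z)<+\infty\}$; $\partial g$ is the convex subdifferential; $\nabla F(x)$ is the $m\times n$ Jacobian of $F$; inequalities between vectors are coordinatewise. For $x\in F^{-1}(\mathrm{dom}\,g)$ and $\bm{\alpha}\in\Gamma$, $p_{\bm{\alpha}}(x)=\mathrm{argmin}_{y\in\mathbb{R}^n} g(H_{\bm{\alpha}}(x,y))$, and for $y\in p_{\bm{\alpha}}(x)$, $$\mathcal{V}_{\bm{\alpha}}(x,y)=\{\nu\in\partial g(H_{\bm{\alpha}}(x,y)):\ \nabla_yH_{\bm{\alpha}}(x,y)^T\nu=0\},$$ where $\nabla_yH_{\bm{\alpha}}(x,y)=\nabla F(x)+\bm{\alpha}(y-x)^T$. Multiproximal method with backtracking step sizes. Given $x_0\in F^{-1}(\mathrm{dom}\,g)$, $\bm{\alpha}_0\in\Gamma$, $\eta>1$, iterate for $k\in\mathbb{N}$: Step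 1. Set $\tilde{\bm{\alpha}}=\bm{\alpha}_k$ and choose $\tilde x\in p_{\tilde{\bm{\alpha}}}(x_k)$. Step 2. While $H_{\tilde{\bm{\alpha}}}(x_k,\tilde x)\ge F(\tilde x)$ is not satisfied: for each $i=1,\dots,m$ such that $f_i(\tilde x)>f_i(x_k)+\nabla f_i(x_k)^T(\tilde x-x_k)+\frac{\tilde\alpha_i}{2}\|\tilde x-x_k\|^2$, replace $\tilde\alpha_i$ by $\eta\tilde\alpha_i$; then choose a new $\tilde x\in p_{\tilde{\bm{\alpha}}}(x_k)$. When the loop ends, set $\bm{\alpha}_{k+1}=\tilde{\bm{\alpha}}$. Step 3. If $x_k\in p_{\bm{\alpha}_{k+1}}(x_k)$, set $x_{k+1}=x_k$; otherwise set $x_{k+1}=\tilde x$. *)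

(* Defs.v *)
(* MathComp-Analysis.  Vectors of R^n are row vectors 'rV[R]_n.  The library norm
   `|x| on 'rV[R]_n is the sup norm, hence the separate Euclidean norm below;
   the topology (interior, continuity, limits) is the library one. *)
From HB Require Import structures.
From mathcomp Require Export all_boot all_order all_algebra.
From mathcomp Require Export all_classical all_reals all_analysis.
Export Order.TTheory GRing.Theory Num.Theory.
Export numFieldNormedType.Exports.

Set Implicit Arguments.
Unset Strict Implicit.
Unset Printing Implicit Defensive.

Local Open Scope classical_set_scope.
Local Open Scope ring_scope.

Section Vectors.
Context {R : realType}.

Definition dotv n (u v : 'rV[R]_n) : R := \sum_i u 0 i * v 0 i.

Definition enorm n (u : 'rV[R]_n) : R := Num.sqrt (\sum_i u 0 i ^+ 2).

Definition vle n (u v : 'rV[R]_n) : Prop := forall i, u 0 i <= v 0 i.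

Definition grad n (f : 'rV[R]_n -> R) (x : 'rV[R]_n) : 'rV[R]_n :=
  \row_j 'D_(delta_mx 0 j) f x.

(* max_(1 <= j <= k) u j; the seed u 1 is itself one of the terms if 1 <= k. *)
Definition max_upto (u : nat -> R) (k : nat) : R :=
  \big[Num.max/u 1%N]_(1 <= j < k.+1) u j.

End Vectors.

Section ExtendedRealFunctions.
Context {R : realType}.
Local Open Scope ereal_scope.

Definition dom (T : Type) (h : T -> \bar R) : set T := [set z | h z < +oo].

Definition proper (T : Type) (h : T -> \bar R) : Prop :=
  (forall z, -oo < h z) /\ dom h !=set0.

Definition argmin (T : Type) (h : T -> \bar R) : set T :=
  [set x | forall y, h x <= h y].

(* Only used together with [proper], so that +oo + -oo does not occur. *)
Definition econvex n (h : 'rV[R]_n -> \bar R) : Prop :=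
  forall (u v : 'rV[R]_n) (t : R), (0 < t < 1)%R ->
    h (t *: u + (1 - t) *: v)%R <= t%:E * h u + (1 - t)%:E * h v.

Definition subdiff n (h : 'rV[R]_n -> \bar R) (z : 'rV[R]_n) : set 'rV[R]_n :=
  [set nu | forall w, h z + (dotv nu (w - z))%:E <= h w].

Definition nondecreasing_arg n (h : 'rV[R]_n -> \bar R) (i : 'I_n) : Prop :=
  forall u v : 'rV[R]_n, (forall j, j != i -> u 0%R j = v 0%R j) ->
    (u 0 i <= v 0 i)%R -> h u <= h v.

End ExtendedRealFunctions.

Section Multiprox.
Context {R : realType} {m n : nat}.
Implicit Types (f : 'I_m -> 'rV[R]_n -> R) (g : 'rV[R]_m -> \bar R).
Implicit Types (a : 'rV[R]_m) (x y : 'rV[R]_n).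

Definition Fmap f x : 'rV[R]_m := \row_i f i x.

Definition Gam (L : 'I_m -> R) : set 'rV[R]_m :=
  [set a | forall i, 0 <= a 0 i /\ (L i = 0 -> a 0 i = 0) /\
                     (0 < L i -> 0 < a 0 i)].

(* In the library's row-vector convention 'J F x has size n x m, i.e. it is the
   transpose of the m x n Jacobian; so grad F(x) (y - x) reads (y - x) *m 'J F x. *)
Definition Hmaj f a x y : 'rV[R]_m :=
  Fmap f x + (y - x) *m 'J (Fmap f) x + (enorm (y - x) ^+ 2 / 2) *: a.

Definition prox f g a x : set 'rV[R]_n := argmin (fun y => g (Hmaj f a x y)).

(* The m x n matrix grad F(x) + a (y - x)^T. *)
Definition grad_yH f a x y : 'M[R]_(m, n) := ('J (Fmap f) x)^T + a^T *m (y - x).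

(* The row nu *m grad_yH is the transpose of (grad_yH)^T nu. *)
Definition multipliers f g a x y : set 'rV[R]_m :=
  [set nu | subdiff g (Hmaj f a x y) nu /\ nu *m grad_yH f a x y = 0].

Definition increase_steps f (eta : R) x y a : 'rV[R]_m :=
  \row_i (if f i x + dotv (grad (f i) x) (y - x) + a 0 i / 2 * enorm (y - x) ^+ 2
             < f i y
          then eta * a 0 i else a 0 i).

(* [backtrack f g eta x a y b z]: the while loop run at the base point x from the
   state (a, y) may end in the state (b, z). *)
Inductive backtrack f g (eta : R) x :
    'rV[R]_m -> 'rV[R]_n -> 'rV[R]_m -> 'rV[R]_n -> Prop :=
| backtrack_stop a y :
    vle (Fmap f y) (Hmaj f a x y) -> backtrack f g eta x a y a y
| backtrack_iter a y y' b z :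
    ~ vle (Fmap f y) (Hmaj f a x y) ->
    prox f g (increase_steps f eta x y a) x y' ->
    backtrack f g eta x (increase_steps f eta x y a) y' b z ->
    backtrack f g eta x a y b z.

Definition multiprox_step f g (eta : R) x a x' a' : Prop :=
  exists y z : 'rV[R]_n,
    [/\ prox f g a x y,
        backtrack f g eta x a y a' z,
        prox f g a' x x -> x' = x
      & ~ prox f g a' x x -> x' = z].

Definition multiprox_bt f g (eta : R) (x0 : 'rV[R]_n) (alpha0 : 'rV[R]_m)
    (x : nat -> 'rV[R]_n) (alpha : nat -> 'rV[R]_m) : Prop :=
  [/\ x 0%N = x0, alpha 0%N = alpha0 &
      forall k, multiprox_step f g eta (x k) (alpha k) (x k.+1) (alpha k.+1)].

End Multiprox.

(* Main.v *)
(* Let H = H_a(x, .), let z minimize g o H and put A = grad H(z), so that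
   H(y) = H(z) + A (y - z) + |y - z|^2 / 2 a.  Of a multiplier nu only the number
   c = nu^T a >= 0 matters, through
     g(H(y) + r a) >= g(H(z)) + c (r + |y - z|^2 / 2)   for all y and r.       (1)
   Such a c exists without any subdifferential calculus: it is the right slope at 0
   of the convex function r |-> inf_d g(H(z) + A d + r a), and the qualification
   condition makes this function finite at some r > 0.
   Since f_i(y) >= f_i(x) + grad f_i(x)^T (y - x), with equality if L_i = 0, (1) gives
     g(F(y) + r a) >= g(F(z)) + c (r + (|y - z|^2 - |y - x|^2) / 2).           (2)
   With y = x_* and r = 0, (2) telescopes to the rate.  With y interior (F(y) in
   int dom g) and r > 0 small, (2) and its instance y = x, r = 0 bound c uniformly
   along the iterates, so g(F(x_k)) -> min.  If no iterate is optimal, every c is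
   positive and (2) makes x_k Fejer monotone with respect to S; a cluster point lies
   in S by lower semicontinuity and is then the limit.  Once an iterate is optimal,
   Step 3 freezes the sequence. *)
Require Import Defs.
From mathcomp Require Import ring lra.

Local Open Scope classical_set_scope.
Local Open Scope ring_scope.

Set Implicit Arguments.
Unset Strict Implicit.
Unset Printing Implicit Defensive.

(** * Inner product, Euclidean norm, and comparison with the sup norm *)

Section EuclideanVectors.
Context {R : realType} {n : nat}.
Implicit Types (u v w : 'rV[R]_n) (t : R).

Lemma dotvC u v : dotv u v = dotv v u.
Proof. by apply: eq_bigr => i _; rewrite mulrC. Qed.

Lemma dotvDl u v w : dotv (u + v) w = dotv u w + dotv v w.
Proof. by rewrite -big_split/=; apply: eq_bigr => i _; rewrite !mxE mulrDl. Qed.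

Lemma dotvZl t u v : dotv (t *: u) v = t * dotv u v.
Proof. by rewrite mulr_sumr; apply: eq_bigr => i _; rewrite !mxE mulrA. Qed.

Lemma dotvDr u v w : dotv u (v + w) = dotv u v + dotv u w.
Proof. by rewrite dotvC dotvDl !(dotvC u). Qed.

Lemma dotvZr t u v : dotv u (t *: v) = t * dotv u v.
Proof. by rewrite dotvC dotvZl (dotvC u). Qed.

Lemma dotvNl u v : dotv (- u) v = - dotv u v.
Proof. by rewrite -scaleN1r dotvZl mulN1r. Qed.

Lemma dotvNr u v : dotv u (- v) = - dotv u v.
Proof. by rewrite dotvC dotvNl (dotvC u). Qed.

Lemma dotv0 : dotv (0 : 'rV[R]_n) 0 = 0.
Proof. by rewrite -{1}(scale0r 0) dotvZl mul0r. Qed.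

Lemma dotv_ge0 u : 0 <= dotv u u.
Proof. by apply: sumr_ge0 => i _; rewrite -expr2 sqr_ge0. Qed.

Lemma dotvBC u v : dotv (u - v) (u - v) = dotv (v - u) (v - u).
Proof. by rewrite -opprB dotvNl dotvNr opprK. Qed.

Lemma enorm_sqr u : enorm u ^+ 2 = dotv u u.
Proof.
rewrite /enorm (_ : \sum_i _ = dotv u u) ?sqr_sqrtr ?dotv_ge0//.
Qed.

Lemma enorm_ge0 u : 0 <= enorm u.
Proof. exact: sqrtr_ge0. Qed.

Lemma dotv_eq0 u : dotv u u = 0 -> u = 0.
Proof.
move=> u0; apply/rowP => i; rewrite mxE; apply/eqP; rewrite -sqrf_eq0 expr2.
by apply/eqP; apply: (psumr_eq0P _ u0) => // j _; rewrite -expr2 sqr_ge0.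
Qed.

(** Cauchy-Schwarz: for [a = enorm u] and [b = enorm v], the squared norm of [b *: u - a *: v]
    equals [2 * a * b * (a * b - dotv u v)]. Zero vectors are set apart so that [a * b] can be
    cancelled. *)
Lemma dotv_le_enorm u v : dotv u v <= enorm u * enorm v.
Proof.
have [u0|u0] := eqVneq (enorm u) 0.
  have -> : u = 0 by apply: dotv_eq0; rewrite -enorm_sqr u0 expr0n.
  by rewrite -(scale0r 0) dotvZl mul0r mulr_ge0 ?enorm_ge0.
have [v0|v0] := eqVneq (enorm v) 0.
  have -> : v = 0 by apply: dotv_eq0; rewrite -enorm_sqr v0 expr0n.
  by rewrite -(scale0r 0) dotvZr mul0r mulr_ge0 ?enorm_ge0.
have p0 : 0 < enorm u * enorm v by rewrite mulr_gt0// lt_def ?u0 ?v0 enorm_ge0.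
have := dotv_ge0 (enorm v *: u - enorm u *: v).
rewrite !(dotvDl, dotvDr, dotvNl, dotvNr, dotvZl, dotvZr) (dotvC v u) -!enorm_sqr.
set a := enorm u in p0 *; set b := enorm v in p0 *; set d := dotv u v => h.
have : 0 <= (a * b) * (a * b - d) by nra.
by rewrite pmulr_rge0// subr_ge0.
Qed.

(** Together with [norm_le_enorm], this carries Euclidean estimates over to the library topology,
    which is that of the sup norm. *)
Lemma dotv_le_norm u : dotv u u <= n%:R * `|u| ^+ 2.
Proof.
rewrite -[n in n%:R]card_ord mulr_natl -sumr_const ler_sum// => i _.
rewrite -expr2 -[leLHS]real_normK ?num_real//.
rewrite lerXn2r ?nnegrE// [`|u|]mx_normrE.
exact: (le_bigmax _ (fun ij : 'I_1 * 'I_n => `|u ij.1 ij.2|) (0, i)).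
Qed.

Lemma norm_le_enorm u : `|u| <= enorm u.
Proof.
rewrite [`|u|]mx_normrE; apply/bigmax_leP; split=> [|[i j] _] /=.
  exact: enorm_ge0.
rewrite -ler_sqr ?nnegrE ?enorm_ge0// real_normK ?num_real// enorm_sqr.
rewrite (ord1 i) /dotv (bigD1 j)//= -expr2 lerDl.
by apply: sumr_ge0 => k _; rewrite -expr2 sqr_ge0.
Qed.

End EuclideanVectors.

(** * Gradient inequality and descent lemma *)

Section ConvexSmooth.
Context {R : realType} {n : nat}.
Variables (f : 'rV[R]_n -> R).
Hypothesis f_diff : forall x, differentiable f x.
Implicit Types (x y v : 'rV[R]_n).

Lemma dotv_grad x v : dotv (grad f x) v = 'D_v f x.
Proof.
rewrite deriveE// [in RHS](row_sum_delta v) linear_sum.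
by apply: eq_bigr => i _; rewrite linearZ/= mxE deriveE// mulrC.
Qed.

(** For [0 < h < 1], convexity bounds the difference quotient at [x] along [y - x] by [f y - f x];
    the bound passes to the right limit. *)
Lemma grad_convex :
  convex_function [set: convex_lmodType 'rV[R]_n] f ->
  forall x y, f x + dotv (grad f x) (y - x) <= f y.
Proof.
move=> fc x y; rewrite dotv_grad addrC -lerBrDr.
have fd : derivable f x (y - x) by exact: diff_derivable.
apply: (cvgr_to_le (cvg_dnbhs_at_right fd)).
near=> h.
have h0 : 0 < h by near: h; exact: nbhs_right_gt.
have h1 : h < 1 by near: h; exact: nbhs_right_lt.
have h01 : Itv.spec (@Itv.num_sem R) (Itv.Real `[0%Z, 1%Z]) h.
  by rewrite /= /Itv.num_sem/= num_real/= in_itv/= !ltW.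
have := fc (Itv.mk h01) y x; rewrite !in_setE => /(_ I I).
rewrite convRE/= => le_f.
rewrite -[_ *: _]/(_ * _) mulrC ler_pdivrMr//.
have -> : h *: (y - x) + x = h *: y + (1 - h) *: x.
  by rewrite scalerBr scalerBl scale1r addrAC -addrA.
by move: le_f; rewrite /unstable.onem mulrBl mul1r; lra.
Unshelve. all: by end_near. Qed.

(** Along the segment, [q] is [f] minus its claimed upper model, up to the constant [f x].
    Cauchy-Schwarz and the Lipschitz bound make its derivative nonpositive, so [q 1 <= q 0]. *)
Lemma descent_lemma (L : R) :
  (forall x y, enorm (grad f x - grad f y) <= L * enorm (x - y)) ->
  forall x y,
    f y <= f x + dotv (grad f x) (y - x) + L / 2 * enorm (y - x) ^+ 2.
Proof.
move=> f_lip x y; set d := y - x.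
pose q : R -> R := (fun t => f (x + t *: d)) -
  (dotv (grad f x) d *: id + (L / 2 * enorm d ^+ 2) *: (id ^+ 2)).
have dfq t : is_derive (t : R) 1 (fun t => f (x + t *: d)) (dotv (grad f (x + t *: d)) d).
  have E : (fun h : R => h^-1 *: (((fun t => f (x + t *: d)) \o shift t) (h *: 1)
      - f (x + t *: d))) =
    (fun h => h^-1 *: ((f \o shift (x + t *: d)) (h *: d) - f (x + t *: d))).
    by apply/funext => h /=; rewrite addrCA -scalerDl -[h *: 1]/(h * 1) mulr1.
  split; last by rewrite dotv_grad /derive E.
  by rewrite /derivable E; exact: diff_derivable.
have dq (t : R) : is_derive t 1 q
    (dotv (grad f (x + t *: d)) d - (dotv (grad f x) d + t * (L * enorm d ^+ 2))).
  have idq := is_derive_id t (1 : R).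
  apply: (is_derive_eq (is_deriveB (dfq t)
    (is_deriveD (is_deriveZ _ idq) (is_deriveZ _ (is_deriveX 2 idq))))).
  congr (_ - (_ + _)).
    by rewrite -[_ *: _]/(_ * _) mulr1.
  by rewrite -![_ *: _]/(_ * _) expr1; field.
suff : q 1 <= q 0.
  rewrite /q !fctE/= scale0r addr0 scale1r /d addrCA subrr addr0.
  by rewrite -![_ *: _]/(_ * _); lra.
apply: (@ler0_derive1_nincr _ q 0 1) => //.
- move=> t; rewrite in_itv/= => /andP[t0 _].
  rewrite derive1E (@derive_val _ _ _ _ _ _ _ (dq t)).
  rewrite opprD addrA subr_le0 -dotvNl -dotvDl.
  apply: le_trans (dotv_le_enorm _ _) _.
  apply: le_trans (ler_wpM2r (enorm_ge0 _) (f_lip _ _)) _.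
  rewrite addrAC subrr add0r.
  have -> : enorm (t *: d) = t * enorm d.
    apply/eqP; rewrite -(@eqrXn2 _ 2) ?mulr_ge0 ?enorm_ge0 ?(ltW t0)//.
    by rewrite exprMn !enorm_sqr dotvZl dotvZr expr2 mulrA.
  by rewrite le_eqVlt; apply/orP; left; apply/eqP; ring.
- by apply: derivable_within_continuous => t _; apply: ex_derive.
Qed.

End ConvexSmooth.

(** * Convexity and monotonicity of extended-real functions *)

Section ExtendedConvex.
Context {R : realType} {m : nat}.
Implicit Types (g : 'rV[R]_m -> \bar R).

(** Real upper bounds keep infinite values out of the arithmetic, and the end weights 0 and 1,
    excluded in [econvex], become available. *)
Lemma econvex_epi g (u v : 'rV[R]_m) (t r s : R) : econvex g -> 0 <= t <= 1 ->
  (g u <= r%:E)%E -> (g v <= s%:E)%E ->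
  (g (t *: u + (1 - t) *: v)%R <= (t * r + (1 - t) * s)%R%:E)%E.
Proof.
move=> gc /andP[t0 t1] gu gv.
have [->|tn0] := eqVneq t 0.
  by rewrite scale0r mul0r !add0r subr0 scale1r mul1r.
have [->|tn1] := eqVneq t 1.
  by rewrite subrr !scale0r mul0r !addr0 scale1r mul1r.
have t01 : 0 < t < 1 by rewrite !lt_neqAle t0 t1 eq_sym tn0 tn1.
apply: le_trans (gc _ _ _ t01) _.
rewrite [leRHS]EFinD !EFinM; apply: leeD; apply: lee_wpmul2l => //.
by rewrite lee_fin subr_ge0.
Qed.

(** The coordinates are switched from [u] to [v] one at a time: [w k] has the first [k] of them from
    [v]. *)
Lemma nondecreasing_vle g (P : pred 'I_m) (u v : 'rV[R]_m) :
  (forall i, P i -> nondecreasing_arg g i) ->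
  vle u v -> (forall i, ~~ P i -> u 0 i = v 0 i) -> (g u <= g v)%E.
Proof.
move=> g_nd uv uvP.
pose w k : 'rV[R]_m := \row_i if (i < k)%N then v 0 i else u 0 i.
have w0 : w 0%N = u by apply/rowP => i; rewrite mxE.
have wm : w m = v by apply/rowP => i; rewrite mxE ltn_ord.
suff le_w k : (k <= m)%N -> (g u <= g (w k))%E by rewrite -wm; exact: le_w.
elim: k => [|k IH] km; first by rewrite w0.
apply: le_trans (IH (ltnW km)) _; pose i := Ordinal km.
have wE j : j != i -> w k 0 j = w k.+1 0 j.
  move=> ji; rewrite !mxE ltnS (leq_eqVlt j) -(inj_eq val_inj) in ji *.
  by rewrite (negbTE ji).
have wi : w k 0 i = u 0 i by rewrite mxE/= ltnn.
have wi' : w k.+1 0 i = v 0 i by rewrite mxE/= ltnS leqnn.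
have [Pi|nPi] := boolP (P i).
  by apply: (g_nd _ Pi) => //; rewrite wi wi' uv.
suff -> : w k = w k.+1 by [].
apply/rowP => j; have [->|/wE//] := eqVneq j i.
by rewrite wi wi' uvP.
Qed.

End ExtendedConvex.

(** * Existence of a scalar multiplier by a slope argument *)

Section ScalarMultiplier.
Context {R : realType} {m n : nat} (g : 'rV[R]_m -> \bar R).
Context (b a : 'rV[R]_m) (A : 'M[R]_(n, m)) (h0 : R).
Hypothesis g_convex : econvex g.
Hypothesis g_b : g b = h0%:E.
Hypothesis g_mono :
  forall u (r s : R), r <= s -> (g (u + r *: a)%R <= g (u + s *: a)%R)%E.
Hypothesis g_min :
  forall d, (h0%:E <= g (b + d *m A + (enorm d ^+ 2 / 2) *: a)%R)%E.
Hypothesis g_slack : exists d (r : R), 0 < r /\ (g (b + d *m A + r *: a)%R < +oo)%E.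

(** The epigraph of a jointly convex function of [(d, r)], restricted to real heights [s]. *)
Let below d r s := (g (b + d *m A + r *: a)%R <= s%:E)%E.

Let below_conv d d' r r' s s' t : 0 <= t <= 1 -> below d r s -> below d' r' s' ->
  below (t *: d + (1 - t) *: d') (t * r + (1 - t) * r') (t * s + (1 - t) * s').
Proof.
move=> t01 bd bd'; have := econvex_epi g_convex t01 bd bd'.
rewrite /below; congr (g _ <= _)%E.
rewrite mulmxDl -!scalemxAl; move: (d *m A) (d' *m A) => x x'.
by apply/rowP => j; rewrite !mxE; ring.
Qed.

Let below0 : below 0 0 h0.
Proof. by rewrite /below mul0mx scale0r !addr0 g_b. Qed.

(* Moving from [b] along [t *: d] makes the quadratic term grow only like [t ^ 2];
   a weight of order [t ^ 2] on the slack point compensates for it. *)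
Let below_ge d s : below d 0 s -> h0 <= s.
Proof.
move=> bd; rewrite leNgt; apply/negP => sh0.
have [d1 [r1 [r10]]] := g_slack.
(* If the value is [-oo], [fine] returns 0, which is still an upper bound. The maximum ensures
   [h0 <= s1]. *)
move=> g1; pose s1 := Num.max h0 (fine (g (b + d1 *m A + r1 *: a))).
have bd1 : below d1 r1 s1.
  rewrite /below; move: g1 @s1; case: (g _) => [z| |]//= _; last by rewrite leNye.
  by rewrite lee_fin le_max lexx orbT.
have s1h0 : h0 <= s1 by rewrite le_max lexx.
move: s1 => s1 in bd1 s1h0.
set q := dotv d d; set q1 := dotv d1 d1.
have q0 : 0 <= q := dotv_ge0 d; have q10 : 0 <= q1 := dotv_ge0 d1.
(* With weight [tau = t ^ 2 * K], the slack gained is [tau * r1 = 2 * t ^ 2 * (q + 1)]; for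
   [t <= 1 / 2] the factor [1 - t] leaves at least [t ^ 2 * (q + 1)], which dominates the quadratic
   term. *)
have [K K0 Kr] : exists2 K : R, 0 < K & K * r1 = 2 * (q + 1).
  exists (2 * (q + 1) / r1); last by rewrite divfK// gt_eqF.
  by rewrite divr_gt0//; lra.
(* The loss [tau * (s1 - h0)] equals [t ^ 2 * e * (h0 - s)], below the gain [t * (h0 - s)] once
   [t * e < 1]. *)
have [e e0 eE] : exists2 e : R, 0 <= e & e * (h0 - s) = K * (s1 - h0).
  exists (K * (s1 - h0) / (h0 - s)); last by rewrite divfK// subr_eq0 gt_eqF.
  by apply: divr_ge0; [rewrite pmulr_rge0//|]; lra.
have Kq : 0 <= K ^+ 2 * q1 by rewrite mulr_ge0// sqr_ge0.
(* Each summand of [N] provides one of the four smallness conditions on [t = 1 / N] derived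
   below. *)
pose N := 2 + K + K ^+ 2 * q1 + e.
have N0 : 0 < N by rewrite /N; lra.
have [t t0 tN] : exists2 t : R, 0 < t & t * N = 1.
  by exists N^-1; rewrite ?invr_gt0// mulVf// gt_eqF.
have t2 : t * 2 <= 1 by rewrite -[leRHS]tN ler_pM2l// /N; lra.
have tK : t * K <= 1 by rewrite -[leRHS]tN ler_pM2l// /N; lra.
have tKq : t * (K ^+ 2 * q1) <= 1 by rewrite -[leRHS]tN ler_pM2l// /N; lra.
have te : t * e < 1 by rewrite -[ltRHS]tN ltr_pM2l// /N; lra.
pose tau := t * (t * K).
have tau01 : 0 <= tau <= 1 by apply/andP; rewrite /tau; split; nra.
have t01 : 0 <= t <= 1 by apply/andP; split; lra.
have bQ := below_conv t01 bd (below_conv tau01 bd1 below0).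
move: bQ; rewrite scaler0 !mulr0 !addr0 add0r scalerA => bQ.
set u := (1 - t) * tau in bQ.
have uE : u = (1 - t) * (t ^+ 2 * K) by rewrite /u /tau; ring.
have le_r : enorm (t *: d + u *: d1) ^+ 2 / 2 <= (1 - t) * (tau * r1).
  rewrite enorm_sqr !(dotvDl, dotvDr, dotvZl, dotvZr) (dotvC d1 d) -/q -/q1.
  have := dotv_ge0 (t *: d - u *: d1).
  rewrite !(dotvDl, dotvDr, dotvNl, dotvNr, dotvZl, dotvZr) (dotvC d1 d) -/q -/q1.
  set p := dotv d d1 => hp.
  have u_le : u ^+ 2 * q1 <= t ^+ 2.
    have X0 : 0 <= t ^+ 2 * K by rewrite mulr_ge0 ?sqr_ge0 ?ltW.
    have u0 : 0 <= u by rewrite uE mulr_ge0//; lra.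
    have : u ^+ 2 <= (t ^+ 2 * K) ^+ 2.
      by rewrite lerXn2r ?nnegrE// uE ler_piMl//; lra.
    move=> /(ler_wpM2r q10)/le_trans; apply.
    have -> : (t ^+ 2 * K) ^+ 2 * q1 = t ^+ 2 * (t * (t * (K ^+ 2 * q1))) by ring.
    by apply: ler_piMr; [exact: sqr_ge0|have := ler_wpM2l (ltW t0) tKq; lra].
  have -> : (1 - t) * (tau * r1) = (1 - t) * t ^+ 2 * (K * r1) by rewrite /tau; ring.
  have : 0 <= (1 - t * 2) * (t ^+ 2 * (q + 1)).
    by apply: mulr_ge0; [|apply: mulr_ge0; [exact: sqr_ge0|]]; lra.
  by rewrite Kr; lra.
have := le_trans (g_min _) (le_trans (g_mono _ le_r) bQ).
rewrite lee_fin => h.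
have : t * (h0 - s) <= t * ((1 - t) * (t * (K * (s1 - h0)))) by move: h; rewrite /tau; lra.
rewrite ler_pM2l// -eE.
have D0 : 0 < h0 - s by lra.
have : t * e * (h0 - s) < h0 - s by rewrite gtr_pMl.
have : 0 <= t * (t * e * (h0 - s)) by do 3?apply: mulr_ge0 => //; exact: ltW.
by lra.
Qed.

(** The multiplier is the infimum of the slopes [(s - h0) / r] over [r > 0]. For [r > 0] the bound
    is the definition of the infimum, for [r = 0] it is [below_ge], and for [r < 0] a convex
    combination with a point at [r' > 0] reduces it to [r = 0]. *)
Lemma exists_scalar_multiplier : exists2 c : R, 0 <= c &
  forall d r, (h0%:E + (c * r)%:E <= g (b + d *m A + r *: a)%R)%E.
Proof.
pose slopes := [set z : R | exists d r s, [/\ 0 < r, below d r s & z = (s - h0) / r]].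
have slopes0 : lbound slopes 0.
  move=> _ [d [r [s [r0 bd ->]]]]; rewrite divr_ge0 ?(ltW r0)// subr_ge0.
  by apply: (@below_ge d); apply: le_trans bd; apply: g_mono; exact: ltW.
have slopesN0 : slopes !=set0.
  have [d [r [r0 gd]]] := g_slack.
  exists ((fine (g (b + d *m A + r *: a)) - h0) / r), d, r, (fine (g (b + d *m A + r *: a))).
  split=> //; rewrite /below; move: gd; case: (g _) => [z| |]//= _.
  by rewrite leNye.
exists (inf slopes); first exact: lb_le_inf.
suff below_slope d r s : below d r s -> h0 + inf slopes * r <= s.
  move=> d r; have := below_slope d r; rewrite /below.
  case: (g _) => [z /(_ z (lexx _))| _ | /(_ (h0 + inf slopes * r - 1) (leNye _))].
  - by rewrite lee_fin.
  - by rewrite leey.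
  - by move=> ?; exfalso; lra.
move=> bd; have [r0|r0|r0] := ltgtP r 0; last first.
- by rewrite r0 in bd *; rewrite mulr0 addr0; exact: below_ge bd.
- rewrite -lerBrDl -ler_pdivlMr//; apply: ge_inf; first by exists 0.
  by exists d, r, s.
rewrite -lerBrDl -ler_ndivrMr//; apply: lb_le_inf => // _ [d' [r' [s' [r'0 bd' ->]]]].
(* This weight solves [t * r + (1 - t) * r' = 0]. *)
pose t := r' / (r' - r).
have rr : 0 < r' - r by lra.
have tE : t * (r' - r) = r' by rewrite /t divfK// gt_eqF.
have t01 : 0 <= t <= 1.
  by rewrite /t divr_ge0 ?(ltW r'0) ?(ltW rr)//= ler_pdivrMr// mul1r; lra.
have := below_conv t01 bd bd'.
have -> : t * r + (1 - t) * r' = 0 by move: tE; lra.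
move=> /below_ge h.
rewrite ler_pdivlMr// mulrAC ler_ndivrMr//.
have : h0 * (r' - r) <= (t * s + (1 - t) * s') * (r' - r) by rewrite ler_pM2r.
have -> : (t * s + (1 - t) * s') * (r' - r) = r' * s - r * s'.
  transitivity (s * (t * (r' - r)) + s' * (r' - r - t * (r' - r))); first by ring.
  by rewrite tE; ring.
by lra.
Qed.

End ScalarMultiplier.

(** * The majorant and the multipliers of one step *)

Section MultiproxStep.
Context {R : realType} {m n : nat}.
Context (f : 'I_m -> 'rV[R]_n -> R) (L : 'I_m -> R) (g : 'rV[R]_m -> \bar R).
Hypothesis f_convex : forall i, convex_function [set: convex_lmodType 'rV[R]_n] (f i).
Hypothesis f_diff : forall i x, differentiable (f i) x.
Hypothesis L_ge0 : forall i, 0 <= L i.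
Hypothesis f_lip : forall i x y,
  enorm (grad (f i) x - grad (f i) y) <= L i * enorm (x - y).
Hypothesis g_convex : econvex g.
Hypothesis g_proper : proper g.
Hypothesis g_nondecr : forall i, 0 < L i -> nondecreasing_arg g i.
Implicit Types (x y z : 'rV[R]_n) (a : 'rV[R]_m).

Lemma differentiable_Fmap x : differentiable (Fmap f) x.
Proof.
have -> : Fmap f = \sum_(i < m) (fun z => f i z *: delta_mx 0 i).
  by apply/funext => z; rewrite fct_sumE [LHS]row_sum_delta;
    apply: eq_bigr => i _; rewrite mxE.
by apply: differentiable_sum => i; exact: differentiableZl.
Qed.

Lemma HmajE a x y i : Hmaj f a x y 0 i =
  f i x + dotv (grad (f i) x) (y - x) + a 0 i / 2 * enorm (y - x) ^+ 2.
Proof.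
rewrite /Hmaj -deriveEjacobian; last exact: differentiable_Fmap.
rewrite derive_mx; last exact/diff_derivable/differentiable_Fmap.
rewrite [LHS]mxE [X in X + _]mxE [X in _ + X]mxE [X in _ + X + _]mxE mxE dotv_grad//.
have -> : (fun t => Fmap f t 0 i) = f i by apply/funext => z; rewrite mxE.
by congr (_ + _); rewrite mulrC mulrA mulrAC.
Qed.

Lemma Hmaj_refl a x : Hmaj f a x x = Fmap f x.
Proof. by rewrite /Hmaj subrr mul0mx enorm_sqr dotv0 mul0r scale0r !addr0. Qed.

(** Expanding [y - x] as [(y - z) + (z - x)], the cross term [dotv (y - z) (z - x)] joins the
    Jacobian to form [grad_yH] at [z]. *)
Lemma Hmaj_recenter a x z y : Hmaj f a x y =
  Hmaj f a x z + (y - z) *m (grad_yH f a x z)^T + (enorm (y - z) ^+ 2 / 2) *: a.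
Proof.
have -> : (y - z) *m (grad_yH f a x z)^T =
    (y - x) *m 'J (Fmap f) x - (z - x) *m 'J (Fmap f) x + dotv (y - z) (z - x) *: a.
  rewrite -mulmxBl /grad_yH linearD/= trmxK trmx_mul trmxK mulmxDr mulmxA.
  congr (_ *m _ + _); first by rewrite opprB addrA subrK.
  rewrite [_ *m _^T]mx11_scalar mul_scalar_mx; congr (_ *: _).
  by rewrite mxE; apply: eq_bigr => i _; rewrite !mxE.
rewrite /Hmaj.
have -> : enorm (y - x) ^+ 2 =
    enorm (z - x) ^+ 2 + 2 * dotv (y - z) (z - x) + enorm (y - z) ^+ 2.
  rewrite !enorm_sqr; have -> : y - x = (y - z) + (z - x) by rewrite addrA subrK.
  move: (y - z) (z - x) => u v.
  by rewrite !(dotvDl, dotvDr) (dotvC v u); ring.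
move: (_ *m _) (_ *m _) => u v.
by apply/rowP => i; rewrite !mxE; field.
Qed.

(** The gradient inequality and the descent lemma with constant 0 bound [f i y] from both sides. *)
Lemma affine_of_L0 i x y : L i = 0 -> f i y = f i x + dotv (grad (f i) x) (y - x).
Proof.
move=> Li; apply/eqP; rewrite eq_le grad_convex// andbT.
have := descent_lemma (f_diff i) (f_lip i) x y.
by rewrite Li !mul0r addr0.
Qed.

Let L0 i : ~~ (0 < L i) -> L i = 0.
Proof. by move=> Li; apply/eqP; rewrite eq_le L_ge0 andbT leNgt. Qed.

Lemma outer_le u v : vle u v -> (forall i, L i = 0 -> u 0 i = v 0 i) -> (g u <= g v)%E.
Proof.
by move=> uv uvL; apply: (nondecreasing_vle g_nondecr uv) => i /L0; exact: uvL.
Qed.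

Lemma outer_le_scale a u r s : Gam L a -> r <= s -> (g (u + r *: a)%R <= g (u + s *: a)%R)%E.
Proof.
move=> aG rs; apply: outer_le => i; rewrite !mxE.
  by rewrite lerD2l ler_wpM2r//; case: (aG i).
by move=> /(aG i).2.1 ->; rewrite !mulr0.
Qed.

(** Removing the quadratic term of the majorant leaves the linearization of [Fmap f] at [x], which
    lies below [Fmap f y], with equality where [L i = 0]. *)
Lemma le_Fmap_shift a x y r : Gam L a ->
  (g (Hmaj f a x y + (r - enorm (y - x) ^+ 2 / 2) *: a)%R <= g (Fmap f y + r *: a)%R)%E.
Proof.
move=> aG; apply: outer_le => i.
  rewrite [leLHS]mxE HmajE !mxE.
  by have := grad_convex (f_diff i) (f_convex i) x y; lra.
move=> Li; rewrite [LHS]mxE HmajE !mxE (affine_of_L0 x y Li) (aG i).2.1//.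
by lra.
Qed.

Lemma outer_Fmap_le a x y : Gam L a -> vle (Fmap f y) (Hmaj f a x y) ->
  (g (Fmap f y) <= g (Hmaj f a x y))%E.
Proof.
move=> aG FH; apply: outer_le => // i Li.
by rewrite HmajE mxE (affine_of_L0 x y Li) (aG i).2.1// mul0r mul0r addr0.
Qed.

Lemma prox_le a x z : prox f g a x z -> (g (Hmaj f a x z) <= g (Fmap f x))%E.
Proof. by move=> /(_ x)/=; rewrite Hmaj_refl. Qed.

(* [c] stands for the product of a multiplier in [multipliers f g a x z] with [a]. *)
Definition scalar_multiplier a x z (c : R) : Prop :=
  0 <= c /\ forall y r, (g (Hmaj f a x z) + (c * (r + enorm (y - z) ^+ 2 / 2))%:E
    <= g (Hmaj f a x y + r *: a)%R)%E.

(** This is (2) with the majorant value at [z] still on the left; it is the multiplier inequality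
    for the shift [r - enorm (y - x) ^+ 2 / 2]. *)
Lemma scalar_multiplier_Fmap a x z c y r : Gam L a -> scalar_multiplier a x z c ->
  (g (Hmaj f a x z) +
     (c * (r + (enorm (y - z) ^+ 2 - enorm (y - x) ^+ 2) / 2))%:E
   <= g (Fmap f y + r *: a)%R)%E.
Proof.
move=> aG [c0 /(_ y (r - enorm (y - x) ^+ 2 / 2))/le_trans].
move=> /(_ _ (le_Fmap_shift x y r aG)); apply: le_trans; apply: leeD => //.
by rewrite lee_fin le_eqVlt; apply/orP; left; apply/eqP; field.
Qed.

Lemma dom_fine w : dom g w -> g w = (fine (g w))%:E.
Proof.
by move=> gw; rewrite fineK// fin_numElt (g_proper.1 w).
Qed.

(** Test the subgradient at [u] minus the [i]-th unit vector, where [g] is no larger; finiteness of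
    [g u] allows cancellation. *)
Lemma subdiff_ge0 u nu i : dom g u -> subdiff g u nu -> 0 < L i -> 0 <= nu 0 i.
Proof.
move=> gu su Li; have := su (u - delta_mx 0 i).
rewrite addrAC subrr add0r dotvNr.
have -> : dotv nu (delta_mx 0 i) = nu 0 i.
  rewrite /dotv (bigD1 i)//= big1 => [|j ji]; rewrite !mxE eqxx/= ?eqxx ?mulr1 ?addr0//.
  by rewrite (negbTE ji) mulr0.
have le_u : (g (u - delta_mx 0 i)%R <= g u)%E.
  apply: (g_nondecr Li) => [j ji|]; rewrite !mxE eqxx/=.
    by rewrite (negbTE ji) subr0.
  by rewrite gerBl.
move=> /le_trans/(_ le_u); rewrite (dom_fine gu) -EFinD lee_fin gerDl.
by rewrite oppr_le0.
Qed.

Lemma multipliers_scalar a x z nu : Gam L a -> dom g (Hmaj f a x z) ->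
  multipliers f g a x z nu -> scalar_multiplier a x z (dotv nu a).
Proof.
move=> aG gH [su nu0]; split=> [|y r].
  apply: sumr_ge0 => i _; have [Li|/L0 Li] := boolP (0 < L i).
    by rewrite mulr_ge0 ?(subdiff_ge0 gH su)//; case: (aG i).
  by rewrite (aG i).2.1// mulr0.
apply: le_trans (su _); rewrite (Hmaj_recenter a x z y).
apply: leeD => //; rewrite lee_fin.
set u := Hmaj _ _ _ _; set v := (y - z) *m _; set e := _ / 2.
have -> : u + v + e *: a + r *: a - u = v + (r + e) *: a.
  by apply/rowP => i; rewrite !mxE; ring.
(* The linear part drops out because [nu] annihilates [grad_yH]. *)
rewrite dotvDr dotvZr; have -> : dotv nu v = 0; last by rewrite add0r mulrC.
have -> : dotv nu v = (nu *m v^T) 0 0.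
  by rewrite mxE; apply: eq_bigr => i _; rewrite [v^T _ _]mxE.
by rewrite trmx_mul trmxK mulmxA nu0 mul0mx mxE.
Qed.

Lemma exists_dom_shift u a : (dom g)° u -> exists2 t : R, 0 < t & dom g (u + t *: a).
Proof.
move=> /nbhs_ballP[e /= e0 ue].
have a1 : 0 < `|a| + 1 by rewrite ltr_wpDl.
exists (e / 2 / (`|a| + 1)); first by rewrite !divr_gt0.
apply: ue; rewrite -ball_normE/= opprD addrA subrr add0r normrN normrZ.
rewrite gtr0_norm ?divr_gt0// mulrAC ltr_pdivrMr//.
have := normr_ge0 a; nra.
Qed.

Lemma scalar_multiplier_exists a x z : Gam L a -> dom g (Fmap f x) ->
  prox f g a x z -> (Fmap f @^-1` (dom g)°) !=set0 ->
  exists c, scalar_multiplier a x z c.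
Proof.
move=> aG gx zP [w /= wD].
have gH : dom g (Hmaj f a x z) by apply: le_lt_trans (prox_le zP) gx.
have [] := @exists_scalar_multiplier _ _ _ g (Hmaj f a x z) a
  (grad_yH f a x z)^T (fine (g (Hmaj f a x z))) g_convex (dom_fine gH).
- by move=> u r s; exact: outer_le_scale.
- move=> d; have zd : z + d - z = d by rewrite addrAC subrr add0r.
  have := Hmaj_recenter a x z (z + d); rewrite zd => <-.
  by rewrite -dom_fine//; exact: zP.
- have [t t0 gt] := exists_dom_shift a wD.
  set q := dotv (w - x) (w - x).
  have q0 : 0 <= q := dotv_ge0 _.
  (* Moving a fraction [s] from [x] towards [w] gains [s * t] in the direction [a], while the
     majorant adds [s ^ 2 * q / 2]; [s * q < t] leaves a positive slack. *)
  have [s s0 [s1 sq]] : exists2 s : R, 0 < s & s < 1 /\ s * q < t.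
    have h : 0 < t + q + 1 by lra.
    exists (t / (t + q + 1)); first by rewrite divr_gt0.
    split; first by rewrite ltr_pdivrMr// mul1r; lra.
    by rewrite mulrAC ltr_pdivrMr// ltr_pM2l//; lra.
  pose y := x + s *: (w - x).
  have xy : y - x = s *: (w - x) by rewrite addrAC subrr add0r.
  exists (y - z), (enorm (y - z) ^+ 2 / 2 + s * (t - s * q / 2)); split.
    rewrite ltr_wpDl//; first by rewrite divr_ge0// sqr_ge0.
    by rewrite mulr_gt0//; lra.
  rewrite scalerDl addrA -Hmaj_recenter.
  have s01 : 0 <= s <= 1 by rewrite !ltW.
  have := econvex_epi g_convex s01.
  move=> /(_ _ _ (fine (g (Fmap f w + t *: a))) (fine (g (Fmap f x)))).
  move=> /(_ (Fmap f w + t *: a) (Fmap f x)).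
  rewrite -!dom_fine// => /(_ (lexx _) (lexx _)) conv_le.
  apply: le_lt_trans (le_lt_trans conv_le (ltry _)).
  apply: outer_le => i.
    rewrite [leLHS]mxE HmajE xy enorm_sqr !(dotvZr, dotvZl) -/q !mxE.
    have := grad_convex (f_diff i) (f_convex i) x w.
    rewrite -(ler_pM2l s0); set p := dotv _ _ => h; lra.
  move=> Li; rewrite [LHS]mxE HmajE xy enorm_sqr !(dotvZr, dotvZl) -/q !mxE.
  by rewrite (affine_of_L0 x w Li) (aG i).2.1//; lra.
move=> c c0 cP; exists c; split=> // y r.
by rewrite (Hmaj_recenter a x z y) -addrA -scalerDl [r + _]addrC [in X in (X <= _)%E]dom_fine.
Qed.

End MultiproxStep.

(** * Invariants of the backtracking loop *)

Section Backtracking.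
Context {R : realType} {m n : nat}.
Context (f : 'I_m -> 'rV[R]_n -> R) (L : 'I_m -> R) (g : 'rV[R]_m -> \bar R).
Hypothesis f_diff : forall i x, differentiable (f i) x.
Hypothesis f_lip : forall i x y,
  enorm (grad (f i) x - grad (f i) y) <= L i * enorm (x - y).
Context (eta : R) (ahat : 'rV[R]_m).
Hypothesis eta_gt1 : 1 < eta.
Hypothesis ahat_ge : forall i, eta * L i <= ahat 0 i.
Implicit Types (x y z : 'rV[R]_n) (a b : 'rV[R]_m).

(** By the descent lemma an entry is raised only if [a 0 i < L i]. Hence it stays below [eta * L i]
    after raising, and entries with [L i = 0] remain 0. *)
Lemma increase_steps_bounds x y a : Gam L a -> vle a ahat ->
  Gam L (increase_steps f eta x y a) /\ vle (increase_steps f eta x y a) ahat.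
Proof.
move=> aG aH.
have lt_L i : f i x + dotv (grad (f i) x) (y - x) + a 0 i / 2 * enorm (y - x) ^+ 2
    < f i y -> a 0 i < L i.
  move=> fy; rewrite ltNge; apply/negP => La; move: fy; apply/negP; rewrite -leNgt.
  apply: le_trans (descent_lemma (f_diff i) (f_lip i) x y) _.
  by rewrite lerD2l ler_wpM2r ?sqr_ge0// ler_wpM2r.
have eta0 : 0 < eta := lt_trans ltr01 eta_gt1.
split=> i; rewrite mxE; case: ifPn => // /lt_L aL.
- have [a0 [_ aP]] := aG i.
  split; first by rewrite mulr_ge0 ?(ltW eta0).
  split=> [Li|/aP ai]; last by rewrite mulr_gt0.
  by move: aL; rewrite Li ltNge a0.
- by apply: le_trans (ahat_ge i); rewrite ler_pM2l// ltW.
Qed.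

Lemma backtrack_invariant x a y b z : backtrack f g eta x a y b z ->
  prox f g a x y -> Gam L a -> vle a ahat ->
  [/\ Gam L b, vle b ahat, prox f g b x z & vle (Fmap f z) (Hmaj f b x z)].
Proof.
elim=> {a y b z} [//|a y y' b z _ y'P _ IH _ aG aH].
by have [] := increase_steps_bounds x y aG aH; exact: IH.
Qed.

(** When Step 3 keeps [x], the loop test holds with equality by [Hmaj_refl]; otherwise the new point
    is the loop's output. *)
Lemma multiprox_step_invariant x a x' a' : multiprox_step f g eta x a x' a' ->
  Gam L a -> vle a ahat ->
  [/\ Gam L a', vle a' ahat, prox f g a' x x' & vle (Fmap f x') (Hmaj f a' x x')].
Proof.
move=> [y [z [yP bt stay move_]]] aG aH.
have [bG bH zP zF] := backtrack_invariant bt yP aG aH.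
have [xP|nxP] := pselect (prox f g a' x x); last by rewrite move_.
by rewrite stay//; split=> // i; rewrite Hmaj_refl.
Qed.

End Backtracking.

(** * Telescoping and finite maxima *)

Section RealSequences.
Context {R : realType}.

(* If [delta k > 0], all coefficients [c j] are positive, hence [D] decreases up to
   [k] and [c j] may be replaced by [M] before telescoping. *)
Lemma telescoping_rate (delta D c : nat -> R) (M : R) (k : nat) :
  (forall j, 0 <= delta j) -> (forall j, delta j.+1 <= delta j) ->
  (forall j, 0 <= D j) -> 0 <= M ->
  (forall j, (j < k)%N -> 0 <= c j.+1 <= M) ->
  (forall j, (j < k)%N -> delta j.+1 <= c j.+1 / 2 * (D j - D j.+1)) ->
  k%:R * delta k <= M / 2 * D 0%N.
Proof.
move=> delta0 delta_dec D0 M0 cM step.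
have dec : nonincreasing_seq delta by exact/nonincreasing_seqP.
have [k0|kn0] := eqVneq (delta k) 0.
  by rewrite k0 mulr0 mulr_ge0// divr_ge0.
have kpos : 0 < delta k by rewrite lt_def kn0 delta0.
suff sum_le j : (j <= k)%N -> j%:R * delta k <= M / 2 * (D 0%N - D j).
  by apply: le_trans (sum_le k (leqnn k)) _; rewrite ler_wpM2l ?divr_ge0// gerBl.
elim: j => [_|j IH jk]; first by rewrite mul0r subrr mulr0.
have := IH (ltnW jk); have := step j jk; have /andP[c0 cM'] := cM j jk.
have dk := dec _ _ jk.
have pos : 0 < c j.+1 / 2 * (D j - D j.+1) by apply: lt_le_trans (le_trans dk (step j jk)).
have DD : 0 <= D j - D j.+1.
  rewrite leNgt; apply/negP => neg; move: pos; apply/negP; rewrite -leNgt.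
  by rewrite mulr_ge0_le0 ?divr_ge0// ltW.
have : c j.+1 / 2 * (D j - D j.+1) <= M / 2 * (D j - D j.+1).
  by rewrite ler_wpM2r// ler_wpM2r.
by rewrite -natr1; lra.
Qed.

End RealSequences.

Lemma max_upto_ge (R : realType) (u : nat -> R) (k j : nat) :
  (0 < j <= k)%N -> u j <= max_upto u k.
Proof.
move=> jk; apply: (@le_bigmax_seq _ _ _ _ _ j xpredT u) => //.
by rewrite mem_index_iota ltnS.
Qed.

(** * Fejer monotone sequences and cluster points *)

Section Convergence.
Context {R : realType} {n : nat}.
Implicit Types (x : nat -> 'rV[R]_n) (p : 'rV[R]_n).

(** For a sup norm [s < 1], [n * s ^ 2 <= n * s], which explains the two terms of the minimum
    [d]. *)
Lemma nbhs_enorm p (e : R) : 0 < e -> \forall z \near p, dotv (z - p) (z - p) < e.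
Proof.
move=> e0; pose d : R := Num.min 1 (e / (n%:R + 1)).
have n1 : 0 < n%:R + 1 :> R by rewrite ltr_wpDl.
have d0 : 0 < d by rewrite lt_min ltr01 divr_gt0.
apply/nbhs_ballP; exists d => //= z; rewrite -ball_normE/= distrC => zd.
apply: le_lt_trans (dotv_le_norm _) _.
have /andP[z1 ze] : (`|z - p| < 1) && (`|z - p| < e / (n%:R + 1)) by rewrite -lt_min.
move: ze; rewrite ltr_pdivlMr// => ze.
have := normr_ge0 (z - p); set s := `|z - p| in z1 ze *; set N : R := n%:R in n1 ze *.
move=> s0; have N0 : 0 <= N by rewrite /N.
have : N * s ^+ 2 <= s * N by rewrite expr2 mulrA [leRHS]mulrC ler_piMr ?mulr_ge0// ltW.
by lra.
Qed.

(** A cluster point has one iterate arbitrarily close to it, and monotonicity keeps all later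
    iterates as close. *)
Lemma fejer_cvg x p : cluster (x @ \oo) p ->
  (forall k, dotv (x k.+1 - p) (x k.+1 - p) <= dotv (x k - p) (x k - p)) ->
  x k @[k --> \oo] --> p.
Proof.
move=> xp fejer; apply/cvgrPdist_lt => e e0.
have e20 : 0 < e ^+ 2 by rewrite exprn_gt0.
have rx : (x @ \oo) (range x) by exists 0%N => // k _; exists k.
have [_ [[N _ <-] pN]] := xp _ _ rx (nbhs_enorm p e20).
have /nonincreasing_seqP dec := fejer.
near=> k.
rewrite distrC; apply: le_lt_trans (norm_le_enorm _) _.
rewrite -ltr_sqr ?nnegrE ?enorm_ge0 ?(ltW e0)// enorm_sqr.
apply: le_lt_trans pN; apply: dec; near: k; exact: nbhs_infty_ge.
Unshelve. all: by end_near. Qed.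

(** The sequence stays in a closed sup-norm ball, which is compact; the added 1 makes the radius
    positive. *)
Lemma bounded_cluster x p (M : R) :
  (forall k, dotv (x k - p) (x k - p) <= M) -> cluster (x @ \oo) !=set0.
Proof.
move=> xM; pose B := closed_ball p (Num.sqrt M + 1).
have s0 : 0 < Num.sqrt M + 1 by rewrite ltr_wpDl ?sqrtr_ge0.
have cB : compact B.
  apply: bounded_closed_compact; last exact: closed_ball_closed.
  exists (`|p| + (Num.sqrt M + 1)); split=> [|N /ltW pN z]; first exact: num_real.
  rewrite /B closed_ballE// /closed_ball_/= => zp.
  apply: le_trans pN; rewrite -[z](subrK p) addrC (le_trans (ler_normD _ _))//.
  by rewrite lerD2l -normrN opprB.
have [|q [_ qx]] := cB (x @ \oo) _.
  exists 0%N => // k _; rewrite /= /B closed_ballE// /closed_ball_/= distrC.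
  apply: le_trans (norm_le_enorm _) _; rewrite ler_wpDr//.
  by rewrite -(ger0_norm (enorm_ge0 (x k - p))) -sqrtr_sqr ler_wsqrtr// enorm_sqr.
by exists q.
Qed.

End Convergence.

(** The first inequality bounds [c * t] up to the cross term of [w - z] and [x - z]. Young's
    inequality with weight [s = (B + 1) / t] absorbs that term into [t / 2] and a multiple of the
    squared norm of [x - z], which the second inequality controls. *)
Lemma multiplier_bound (R : realType) (n : nat) (w x z : 'rV[R]_n)
    (c t W mu v B : R) :
  0 <= c -> 0 < t -> dotv (w - z) (w - z) <= B ->
  mu + c * (t + (dotv (w - z) (w - z) - dotv (w - x) (w - x)) / 2) <= W ->
  mu + c * (dotv (x - z) (x - z) / 2) <= v ->
  c <= (W - mu + ((B + 1) / t + 1) * (v - mu)) * (2 / t).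
Proof.
move=> c0 t0 wB hW hv.
have B0 : 0 <= B by apply: le_trans wB; exact: dotv_ge0.
have [s s0 st] : exists2 s : R, 0 < s & s * t = B + 1.
  by exists ((B + 1) / t); rewrite ?divr_gt0 ?ltr_wpDl// divfK// gt_eqF.
have -> : (B + 1) / t = s by rewrite -st mulfK// gt_eqF.
have wxE : w - x = (w - z) - (x - z) by rewrite opprB addrA subrK.
move: hW; rewrite {}wxE; move: (w - z) (x - z) wB hv => u e uB hv.
rewrite !(dotvDl, dotvDr, dotvNl, dotvNr) (dotvC e u) => hW.
have := dotv_ge0 (u + s *: e).
rewrite !(dotvDl, dotvDr, dotvZl, dotvZr) (dotvC e u).
have u0 := dotv_ge0 u; have e0 := dotv_ge0 e.
move: (dotv u u) (dotv e e) (dotv u e) => uu ee ue in u0 e0 uB hW hv *.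
move=> young.
have young2 : - 2 * ue <= t + s * ee.
  rewrite -(ler_pM2l s0).
  have : s * (- 2 * ue) <= uu + s * (s * ee) by lra.
  move=> /le_trans; apply; rewrite mulrDr st; lra.
have h1 : 0 <= c * (t + s * ee + 2 * ue) by rewrite mulr_ge0//; lra.
have h2 : 0 <= s * (v - mu - c * (ee / 2)) by rewrite mulr_ge0 ?(ltW s0)//; lra.
rewrite mulrA ler_pdivlMr//.
lra.
Qed.

(** * Descent inequality and stationarity at minimizers *)

Section MultiproxIterates.
Context {R : realType} {m n : nat}.
Context (f : 'I_m -> 'rV[R]_n -> R) (L : 'I_m -> R) (g : 'rV[R]_m -> \bar R).
Hypothesis f_convex : forall i, convex_function [set: convex_lmodType 'rV[R]_n] (f i).
Hypothesis f_diff : forall i x, differentiable (f i) x.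
Hypothesis L_ge0 : forall i, 0 <= L i.
Hypothesis f_lip : forall i x y,
  enorm (grad (f i) x - grad (f i) y) <= L i * enorm (x - y).
Hypothesis g_nondecr : forall i, 0 < L i -> nondecreasing_arg g i.
Implicit Types (x y z : 'rV[R]_n) (a : 'rV[R]_m).

(** This is (2): the accepted loop test replaces the majorant value at [z] by [g (Fmap f z)]. *)
Lemma multiprox_descent a x z c y r : Gam L a ->
  vle (Fmap f z) (Hmaj f a x z) -> scalar_multiplier f g a x z c ->
  (g (Fmap f z) + (c * (r + (dotv (y - z) (y - z) - dotv (y - x) (y - x)) / 2))%:E
   <= g (Fmap f y + r *: a)%R)%E.
Proof.
move=> aG FH sm; rewrite -!enorm_sqr.
apply: le_trans (scalar_multiplier_Fmap f_convex f_diff L_ge0 f_lip g_nondecr y r aG sm).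
by apply: leeD => //; exact: (outer_Fmap_le f_convex f_diff L_ge0 f_lip g_nondecr).
Qed.

(** The value at [x] is at most [g (Fmap f z)], hence at most the minimal majorant value, so Step 3
    keeps [x]. *)
Lemma prox_self a x z : argmin (g \o Fmap f) x -> Gam L a -> prox f g a x z ->
  vle (Fmap f z) (Hmaj f a x z) -> prox f g a x x.
Proof.
move=> xS aG zP FH y /=; rewrite Hmaj_refl.
apply: le_trans (xS z) (le_trans _ (zP y)).
exact: (outer_Fmap_le f_convex f_diff L_ge0 f_lip g_nondecr).
Qed.

End MultiproxIterates.

(** * Rate and convergence of the method *)

Unset Implicit Arguments.
Set Strict Implicit.
Set Printing Implicit Defensive.

Theorem theorem3 (R : realType) (m n : nat)
  (f : 'I_m -> 'rV[R]_n -> R) (L : 'I_m -> R)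
  (g : 'rV[R]_m -> \bar R) (Lg : R)
  (f_convex : forall i, convex_function [set: convex_lmodType 'rV[R]_n] (f i))
  (f_diff : forall i x, differentiable (f i) x)
  (f_C1 : forall i, continuous (grad (f i)))
  (L_ge0 : forall i, 0 <= L i)
  (f_lip : forall i x y,
     enorm (grad (f i) x - grad (f i) y) <= L i * enorm (x - y))
  (g_convex : econvex g)
  (g_proper : proper g)
  (g_lsc : lower_semicontinuous g)
  (g_lip : forall u v, dom g u -> dom g v ->
     (`|g u - g v| <= (Lg * enorm (u - v))%:E)%E)
  (g_nondecr : forall i, 0 < L i -> nondecreasing_arg g i)
  (gF_proper : proper (g \o Fmap f))
  (gF_min : argmin (g \o Fmap f) !=set0)
  (qualification : (Fmap f @^-1` (dom g)°) !=set0)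
  (prox_nonempty : forall x a, (Fmap f @^-1` dom g) x -> Gam L a ->
     prox f g a x !=set0)
  (x0 : 'rV[R]_n) (alpha0 : 'rV[R]_m) (eta : R)
  (x0_dom : (Fmap f @^-1` dom g) x0)
  (alpha0_Gam : Gam L alpha0)
  (eta_gt1 : 1 < eta)
  (x : nat -> 'rV[R]_n) (alpha : nat -> 'rV[R]_m)
  (x_alpha_gen : multiprox_bt f g eta x0 alpha0 x alpha) :
  let S := argmin (g \o Fmap f) in
  let alphahat : 'rV[R]_m := \row_i Num.max (eta * L i) (alpha0 0 i) in
  (forall (xstar : 'rV[R]_n) (nu : nat -> 'rV[R]_m),
     S xstar ->
     (forall j, (1 <= j)%N -> multipliers f g (alpha j) (x j.-1) (x j) (nu j)) ->
     forall k, (1 <= k)%N ->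
       (g (Fmap f (x k)) - g (Fmap f xstar) <=
        (max_upto (fun j => dotv alphahat (nu j)) k / (2 * k%:R)
           * enorm (x0 - xstar) ^+ 2)%:E)%E) /\
  (exists2 xbar : 'rV[R]_n, S xbar & x k @[k --> \oo] --> xbar).
Proof.
move=> S ahat.
have [x_0 alpha_0 steps] := x_alpha_gen.
have ahat_ge i : eta * L i <= ahat 0 i by rewrite mxE le_max lexx.
have ahat0 i : L i = 0 -> ahat 0 i = 0.
  by move=> Li; rewrite mxE Li mulr0 (alpha0_Gam i).2.1// maxxx.
have alphaP k : Gam L (alpha k) /\ vle (alpha k) ahat.
  elim: k => [|k [aG aH]].
    by rewrite alpha_0; split=> // i; rewrite mxE le_max lexx orbT.
  by have [] := multiprox_step_invariant f_diff f_lip eta_gt1 ahat_ge (steps k) aG aH.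
have stepP k : prox f g (alpha k.+1) (x k) (x k.+1) /\
    vle (Fmap f (x k.+1)) (Hmaj f (alpha k.+1) (x k) (x k.+1)).
  have [aG aH] := alphaP k.
  by have [] := multiprox_step_invariant f_diff f_lip eta_gt1 ahat_ge (steps k) aG aH.
have decE k : (g (Fmap f (x k.+1)) <= g (Fmap f (x k)))%E.
  have [xP xF] := stepP k; apply: le_trans (prox_le xP).
  exact: (outer_Fmap_le f_convex f_diff L_ge0 f_lip g_nondecr (alphaP k.+1).1).
have domx k : dom g (Fmap f (x k)).
  by elim: k => [|k IH]; [rewrite x_0|exact: le_lt_trans (decE k) IH].
have domH k : dom g (Hmaj f (alpha k.+1) (x k) (x k.+1)).
  exact: le_lt_trans (prox_le (stepP k).1) (domx k).
pose v k := fine (g (Fmap f (x k))).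
have vE k : g (Fmap f (x k)) = (v k)%:E := dom_fine g_proper (domx k).
have domS y : S y -> dom g (Fmap f y) by move=> yS; exact: le_lt_trans (yS x0) x0_dom.
pose D y k := dotv (x k - y) (x k - y).
have smD y c k : S y -> scalar_multiplier f g (alpha k.+1) (x k) (x k.+1) c ->
    v k.+1 - fine (g (Fmap f y)) <= c / 2 * (D y k - D y k.+1).
  move=> yS sm; have := multiprox_descent f_convex f_diff L_ge0 f_lip g_nondecr
    y 0 (alphaP k.+1).1 (stepP k).2 sm.
  rewrite vE scale0r addr0 (dom_fine g_proper (domS y yS)) -EFinD lee_fin.
  by rewrite (dotvBC y) (dotvBC y (x k)) -/(D y k) -/(D y k.+1); lra.
have v_ge y k : S y -> 0 <= v k - fine (g (Fmap f y)).
  move=> yS; have := yS (x k); rewrite /= vE (dom_fine g_proper (domS y yS)) lee_fin.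
  by rewrite subr_ge0.
have v_dec y k : v k.+1 - fine (g (Fmap f y)) <= v k - fine (g (Fmap f y)).
  by have := decE k; rewrite !vE lee_fin; rewrite lerD2r.
split.
  move=> y nu yS nuP k k1; set M := max_upto _ k.
  have smc j : scalar_multiplier f g (alpha j.+1) (x j) (x j.+1) (dotv (nu j.+1) (alpha j.+1)).
    apply: (multipliers_scalar L_ge0 g_proper g_nondecr (alphaP j.+1).1 (domH j)).
    exact: (nuP j.+1).
  (* [alpha j.+1] is replaced by [ahat]: entries of the multiplier are nonnegative where [L i > 0],
     and both vectors vanish where [L i = 0]. *)
  have cM j : (j < k)%N -> 0 <= dotv (nu j.+1) (alpha j.+1) <= M.
    move=> jk; rewrite (smc j).1/=.
    apply: le_trans (@max_upto_ge _ (fun j => dotv ahat (nu j)) k j.+1 _) => //.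
    apply: ler_sum => i _; rewrite mulrC.
    have [Li|Li] := eqVneq (L i) 0.
      by rewrite ahat0// ((alphaP j.+1).1 i).2.1// !mul0r.
    rewrite ler_wpM2r ?((alphaP j.+1).2 i)//.
    apply: (subdiff_ge0 g_proper g_nondecr (domH j) (nuP j.+1 isT).1).
    by rewrite lt_def Li L_ge0.
  have M0 : 0 <= M by have /andP[] := cM 0%N k1; exact: le_trans.
  have := @telescoping_rate _ (fun k => v k - fine (g (Fmap f y))) (D y)
    (fun j => dotv (nu j) (alpha j)) M k (v_ge y ^~ yS) (v_dec y)
    (fun=> dotv_ge0 _) M0 cM (fun j _ => smD y _ j yS (smc j)).
  rewrite vE (dom_fine g_proper (domS y yS)) -EFinB lee_fin enorm_sqr /D x_0.
  have k0 : 0 < k%:R :> R by rewrite ltr0n.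
  by rewrite [2 * _]mulrC invfM mulrA mulrAC -mulrA -ler_pdivlMl//
    mulrC [leRHS]mulrC mulrA => h; lra.
have [y yS] := gF_min.
have [[K xKS]|nS] := pselect (exists K, S (x K)).
  exists (x K) => //.
  have xcst k : (K <= k)%N -> x k = x K.
    elim: k => [|k IH]; first by rewrite leqn0 => /eqP->.
    rewrite leq_eqVlt => /predU1P[->//|/IH xk].
    have [z' [z [_ _ stay _]]] := steps k.
    rewrite -xk in xKS *; apply: stay; have [xP xF] := stepP k.
    exact: (prox_self f_convex f_diff L_ge0 f_lip g_nondecr xKS (alphaP k.+1).1 xP xF).
  by apply: (@cvg_near_cst _ _ _ x); near do apply: xcst; exact: nbhs_infty_ge.
have v_gt u k : S u -> 0 < v k - fine (g (Fmap f u)).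
  move=> uS; rewrite lt_def v_ge// andbT; apply/eqP => /subr0_eq vu.
  by apply: nS; exists k => w /=; rewrite vE vu -(dom_fine g_proper (domS u uS)); exact: uS.
(* Convergence is claimed without given multipliers, so scalar ones come from the qualification
   condition. *)
have [c cP] := choice (fun k => scalar_multiplier_exists f_convex f_diff L_ge0 f_lip
  g_convex g_proper g_nondecr (alphaP k.+1).1 (domx k) (stepP k).1 qualification).
(* A positive gap on the left of [smD] excludes an increase of the distance on its right, since
   [c k >= 0]. *)
have fejer u k : S u -> D u k.+1 <= D u k.
  move=> uS; rewrite -subr_ge0 leNgt; apply/negP => lt0.
  have := lt_le_trans (v_gt u k.+1 uS) (smD u _ k uS (cP k)).
  by apply/negP; rewrite -leNgt mulr_ge0_le0 ?(ltW lt0)// divr_ge0 ?(cP k).1.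
have fejer0 u k : S u -> D u k <= D u 0%N.
  by move=> uS; elim: k => // k; apply: le_trans; exact: fejer.
have [M M0 cM] : exists2 M, 0 <= M & forall k, 0 <= c k <= M.
  have [w /= wD] := qualification.
  (* Shifting along [ahat] gives one finite bound [W] valid for every [alpha k.+1], by
     monotonicity. *)
  have [t t0 Wdom] := exists_dom_shift ahat wD.
  pose mu := fine (g (Fmap f y)).
  pose W := fine (g (Fmap f w + t *: ahat)).
  (* The parallelogram bound on [w - x k.+1], with Fejer monotonicity relative to [y]. *)
  pose B := 2 * dotv (w - y) (w - y) + 2 * D y 0%N.
  pose M := (W - mu + ((B + 1) / t + 1) * (v 0%N - mu)) * (2 / t).
  have cM k : 0 <= c k <= M.
    have ck0 := (cP k).1; rewrite ck0/=.
    have vk0 j : v j <= v 0%N.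
      by elim: j => // j; apply: le_trans; have := decE j; rewrite !vE lee_fin.
    have muv j : mu <= v j by rewrite -subr_ge0; exact: v_ge.
    have desc := multiprox_descent f_convex f_diff L_ge0 f_lip g_nondecr
      _ _ (alphaP k.+1).1 (stepP k).2 (cP k).
    apply: (@multiplier_bound _ _ w (x k) (x k.+1)) => //.
    - have := fejer0 y k.+1 yS; rewrite /B; move: (D y 0%N) => d0; rewrite /D.
      have -> : w - x k.+1 = (w - y) - (x k.+1 - y) by rewrite opprB addrA subrK.
      move: (w - y) (x k.+1 - y) => p q qD; have := dotv_ge0 (p + q).
      by rewrite !(dotvDl, dotvDr, dotvNl, dotvNr) (dotvC q p); lra.
    - have := desc w t; rewrite vE => /le_trans h.
      have : (g (Fmap f w + t *: alpha k.+1)%R <= W%:E)%E.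
        rewrite -(dom_fine g_proper Wdom).
        apply: (outer_le L_ge0 g_nondecr) => i; rewrite !mxE.
          by rewrite lerD2l ler_pM2l//; have := (alphaP k.+1).2 i; rewrite mxE.
        by move=> Li; have := ahat0 _ Li; rewrite mxE => ->; rewrite ((alphaP k.+1).1 i).2.1.
      by move=> /h; rewrite -EFinD lee_fin; apply: le_trans; rewrite lerD2r.
    - have := desc (x k) 0; rewrite !vE scale0r addr0 vE -EFinD lee_fin.
      rewrite subrr dotv0 subr0 add0r => h; apply: le_trans (vk0 k); apply: le_trans h.
      by rewrite lerD2r.
  by exists M => //; have /andP[] := cM 0%N; exact: le_trans.
have rate k : k%:R * (v k - fine (g (Fmap f y))) <= M / 2 * D y 0%N.
  (* The predecessor realigns indices: [c k] belongs to the step from [k] to [k.+1]. *)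
  apply: (@telescoping_rate _ (fun k => v k - fine (g (Fmap f y)))
    (D y) (fun j => c j.-1)) => //.
  - by move=> j; exact: v_ge.
  - by move=> j; exact: dotv_ge0.
  - by move=> j _; exact: smD.
have [p px] := bounded_cluster (fun k => fejer0 y k yS).
suff pS : S p by exists p => //; apply: fejer_cvg => // k; exact: fejer.
suff : (g (Fmap f p) <= g (Fmap f y))%E by move=> py z; exact: le_trans py (yS z).
rewrite leNgt (dom_fine g_proper (domS y yS)); apply/negP => lt_p.
set mu := fine _ in rate lt_p.
(* Lower semicontinuity would keep [g] above [b > mu] near [Fmap f p], hence at iterates of
   arbitrarily large index, against the rate. *)
have [b mub bp] : exists2 b : R, mu < b & (b%:E < g (Fmap f p))%E.
  move: lt_p; case: (g _) => [r| |]//=.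
  - by rewrite lte_fin => ?; exists ((mu + r) / 2); rewrite ?lte_fin; lra.
  - by exists (mu + 1); rewrite ?ltry// ltrDl.
have [V VF bV] := g_lsc _ _ bp.
have Vp : nbhs p (Fmap f @^-1` V).
  exact: (differentiable_continuous (differentiable_Fmap f_diff p)).
pose N := (Num.truncn (M / 2 * D y 0%N / (b - mu))).+1.
have xN : (x @ \oo) (x @` [set k | (N <= k)%N]) by exists N => // k Nk; exists k.
have [_ [[k Nk <-] /bV]] := px _ _ xN Vp.
rewrite vE lte_fin => bv.
have bmu : 0 < b - mu by rewrite subr_gt0.
have : M / 2 * D y 0%N / (b - mu) < k%:R.
  by apply: lt_le_trans (truncnS_gt _) _; rewrite ler_nat.
rewrite ltr_pdivrMr// => h; have := le_lt_trans (rate k) h.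
by apply/negP; rewrite -leNgt ler_wpM2l// lerD2r ltW.
Unshelve. all: by end_near. Qed.
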